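(* Let $q>0$, $q\neq1$, let $x,y\in\mathbb{Z}_{\ge 0}$, and let either $|bcd|<1$ and $0<q<1$, or $a=q^{-N}$ for some $N\in\mathbb{Z}_{\ge 0}$. Then the following summation formula holds between ${}_3\varphi_2$'s in base $q^{-1}$ and a rational function which is a ${}_4\varphi_3$ of $q$-Racah type: $$\frac{(abcd;q)_\infty}{(bcd;q)_\infty}\,\frac{(bdq^{-y}/c;q)_y}{(abcd;q)_y}\,\frac{(q^{-x}/b^2;q)_x}{(a;q)_x}\;{}_4\varphi_3\!\left(\begin{matrix}q^{-x},\,ab^2q^x,\,bcd,\,bd/c\\ b^2q,\,bdq^{-y}/c,\,abcdq^y\end{matrix};q,q\right)$$ $$=\sum_{n=0}^\infty (bcd)^n\frac{(a;q)_n}{(q;q)_n}\;{}_3\varphi_2\!\left(\begin{matrix}q^n,\,q^x,\,q^{-x}/(ab^2)\\ 1/a,\,0\end{matrix};q^{-1},q^{-1}\right){}_3\varphi_2\!\left(\begin{matrix}q^n,\,q^y,\,q^{-y}/(ac^2)\\ 1/a,\,0\end{matrix};q^{-1},q^{-1}\right).$$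
   Context: $a,b,c,d$ are complex parameters. $(\alpha;q)_n=(1-\alpha)(1-\alpha q)\cdots(1-\alpha q^{n-1})$ with $(\alpha;q)_0=1$, and $(\alpha;q)_\infty=\lim_{n\to\infty}(\alpha;q)_n$ for $0<q<1$. For a base $p>0$, $p\ne1$, $${}_{r+1}\varphi_r\!\left(\begin{matrix}a_1,\dots,a_{r+1}\\ b_1,\dots,b_r\end{matrix};p,z\right)=\sum_{j=0}^\infty\frac{(a_1;p)_j\cdots(a_{r+1};p)_j}{(b_1;p)_j\cdots(b_r;p)_j}\frac{z^j}{(p;p)_j}.$$ The series above terminate: $(q^{-x};q)_j=0$ for $j>x$, and $(q^n;q^{-1})_j=0$ for $j>n$. If $a=q^{-N}$, the sum over $n$ terminates because $(q^{-N};q)_n=0$ for $n>N$, and the ratio $(abcd;q)_\infty/(bcd;q)_\infty$ is read as $(q^{-N}bcd;q)_N$.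
   Formalization: All displayed denominators are assumed nonzero (up to the index where each series terminates), and a, b, c are nonzero; for a=q^{-N} this forces x,y≤N, and the formula is false for y>N (e.g. N=x=0, y=1). *)

(* Defs.v *)
From HB Require Import structures.
From mathcomp Require Import all_boot all_order all_algebra.
From mathcomp Require Import complex.
From mathcomp Require Import all_classical all_reals all_analysis.

Set Implicit Arguments.
Unset Strict Implicit.
Unset Printing Implicit Defensive.

Import Order.TTheory GRing.Theory Num.Theory.
Import numFieldNormedType.Exports.

Local Open Scope classical_set_scope.
Local Open Scope ring_scope.

(* Seen as a numClosedFieldType, R[i] gets the topology of its modulus from
   the generic instances of numFieldNormedType.Exports; there is none on
   complex R itself.  The order is partial: 0 < q holds exactly when q is a
   positive real number. *)
Definition Cplx (R : realType) : numClosedFieldType := (R[i])%C.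

Section QSeries.
Variable C : numClosedFieldType.
Implicit Types (al p z : C) (us ls : seq C) (n : nat).

Definition qpoch al p n : C := \prod_(i < n) (1 - al * p ^+ i).

Definition qpoch_inf al p : C := limn (qpoch al p).

(* us and ls are the upper and lower parameters.  If some u in us has
   (u; p)_n = 0, the term is 0 even when a lower factor vanishes too, since
   0^-1 = 0; so a terminating series has eventually constant partial sums. *)
Definition qphi_term us ls p z n : C :=
  (\prod_(u <- us) qpoch u p n) / (\prod_(l <- ls) qpoch l p n)
  * (z ^+ n / qpoch p p n).

Definition qphi us ls p z : C := limn (series (qphi_term us ls p z)).

End QSeries.

(* Main.v *)
Require Import Defs.
From HB Require Import structures.
From mathcomp Require Import all_boot all_order all_algebra.
From mathcomp Require Import complex ring lra.
From mathcomp Require Import all_classical all_reals all_analysis.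
Import Order.TTheory GRing.Theory Num.Theory.
Import numFieldNormedType.Exports.
Local Open Scope classical_set_scope.
Local Open Scope ring_scope.

(* Write t = bcd and c_n = (a;q)_n/(q;q)_n.  The q-binomial theorem gives
   E(t) = sum_n c_n t^n, equal to (at;q)_oo/(t;q)_oo, or to (at;q)_N when
   a = q^-N; in both cases (1 - at) E(tq) = (1 - t) E(t).  Hence
   sum_n c_n t^n (q^n;1/q)_j = E(t) t^j (a;q)_j/(at;q)_j, and expanding one
   3phi2 in the (q^n;1/q)_j, the q-Chu-Vandermonde sum evaluates the generating
   function of a single 3phi2 as
     G(t) = E(t) (tq^-y/c^2;q)_y/(at;q)_y.
   The other 3phi2 is also a terminating 2phi1 in q^n (q-Chu-Vandermonde again),
   that is, a linear combination of the powers q^(nk) with k <= x, so the sum of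
   the products is the same combination of the G(tq^k), which is the 4phi3. *)

(** * Finite q-shifted factorials and the q-Chu-Vandermonde sum *)

Section Algebra.
Set Implicit Arguments.
Unset Strict Implicit.
Variable C : numClosedFieldType.
Implicit Types (a b c q t u z al p : C) (i j k m n x y : nat).

Lemma prodrMl_ord n z (f : 'I_n -> C) :
  \prod_(i < n) (z * f i) = z ^+ n * \prod_(i < n) f i.
Proof. by rewrite big_split prodr_const card_ord. Qed.

Lemma qpoch0 al p : qpoch al p 0 = 1.
Proof. by rewrite /qpoch big_ord0. Qed.

Lemma qpochS al p n : qpoch al p n.+1 = qpoch al p n * (1 - al * p ^+ n).
Proof. by rewrite /qpoch big_ord_recr. Qed.

Lemma qpochSl al p n : qpoch al p n.+1 = (1 - al) * qpoch (al * p) p n.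
Proof.
rewrite /qpoch big_ord_recl expr0 mulr1; congr (_ * _).
by apply: eq_bigr => i _; rewrite /= /bump leq0n add1n exprS mulrA.
Qed.

Lemma qpochD al p m n :
  qpoch al p (m + n) = qpoch al p m * qpoch (al * p ^+ m) p n.
Proof.
elim: n => [|n IHn]; first by rewrite addn0 qpoch0 mulr1.
by rewrite addnS !qpochS IHn -!mulrA -exprD.
Qed.

Lemma qpoch_split al p m n : (m <= n)%N ->
  qpoch al p n = qpoch al p m * qpoch (al * p ^+ m) p (n - m).
Proof. by move=> le_mn; rewrite -qpochD subnKC. Qed.

Lemma qpoch_neq0W al p m n : (m <= n)%N -> qpoch al p n != 0 -> qpoch al p m != 0.
Proof.
by move=> /subnKC <-; rewrite qpochD mulf_eq0 negb_or => /andP[].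
Qed.

Lemma qpoch_eq0 al p i n : (i < n)%N -> al * p ^+ i = 1 -> qpoch al p n = 0.
Proof.
move=> lt_in al1; apply/eqP; apply: contraT => /(qpoch_neq0W lt_in).
by rewrite qpochS al1 subrr mulr0 eqxx.
Qed.

Section Base.
Variable q : C.
Hypotheses (q_neq0 : q != 0) (q_expr : forall n, q ^+ n.+1 != 1).

Lemma qpoch_self_neq0 n : qpoch q q n != 0.
Proof.
elim: n => [|n IHn]; first by rewrite qpoch0 oner_eq0.
by rewrite qpochS mulf_neq0// -exprS subr_eq0 eq_sym.
Qed.

Lemma qpochVexp_eq0 n k : (n < k)%N -> qpoch (q ^- n) q k = 0.
Proof. by move=> lt_nk; rewrite (@qpoch_eq0 _ _ n)// mulVf// expf_neq0. Qed.

(* This is (-1)^j q^(j(j-1)/2) times the Gaussian binomial [n choose j]; this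
   form vanishes for j > n and needs no truncated subtraction. *)
Definition sbinom n j := qpoch (q ^- n) q j / qpoch q q j * q ^+ (n * j).

Lemma sbinom0 n : sbinom n 0 = 1.
Proof. by rewrite /sbinom !qpoch0 muln0 divr1 mulr1. Qed.

Lemma sbinom_eq0 n k : (n < k)%N -> sbinom n k = 0.
Proof. by move=> ltnk; rewrite /sbinom qpochVexp_eq0// !mul0r. Qed.

(** The q-Pascal rule [n+1, j+1] = q^(j+1) [n, j+1] + [n, j], multiplied by the sign and the power
    of q that [sbinom] carries. *)
Lemma sbinomS n j :
  sbinom n.+1 j.+1 = q ^+ j.+1 * sbinom n j.+1 - q ^+ j * sbinom n j.
Proof.
rewrite /sbinom qpochSl !qpochS.
have -> : q ^- n.+1 * q = q ^- n by rewrite exprS; field; rewrite expf_neq0 ?q_neq0.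
have hq : 1 - q * q ^+ j != 0 by rewrite subr_eq0 eq_sym -exprS.
rewrite !mulnS !mulSn !exprD !exprS !invfM.
have hn := expf_neq0 n q_neq0; have hj := qpoch_self_neq0 j.
by field; rewrite hq hn hj q_neq0.
Qed.

(** Homogeneous form without division by c, so that c = 0 is allowed. By the q-Pascal rule the sum
    for n + 1 is 1 - u times the sum for n at (uq, cq). *)
Lemma qChuVandermonde n u c :
  \sum_(j < n.+1) sbinom n j * \prod_(i < j) (u - c * q ^+ i)
    * qpoch (c * q ^+ j) q (n - j) = qpoch u q n.
Proof.
elim: n u c => [|n IHn] u c.
  by rewrite big_ord_recl big_ord0 addr0 sbinom0 big_ord0 !qpoch0 !mulr1.
pose X (j : nat) := \prod_(i < j) (u - c * q ^+ i) * qpoch (c * q ^+ j) q (n.+1 - j).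
under eq_bigr => j _ do rewrite -mulrA -/(X j).
rewrite big_ord_recl sbinom0 mul1r.
under eq_bigr => j _ do rewrite /= /bump leq0n add1n sbinomS mulrBl.
rewrite sumrB addrA.
(* [X 0] is the missing first term of the shifted sum, whose last term vanishes with
   [sbinom n n.+1]. What remains is the sum of q^j [sbinom n j] (X j - X (j+1)). *)
have -> : X 0%N + \sum_(j < n.+1) q ^+ j.+1 * sbinom n j.+1 * X j.+1
    = \sum_(j < n.+1) q ^+ j * sbinom n j * X j.
  rewrite [RHS]big_ord_recl sbinom0 expr0 !mul1r; congr (_ + _).
  by rewrite big_ord_recr /= sbinom_eq0// mulr0 mul0r addr0.
rewrite -sumrB qpochSl -(IHn (u * q) (c * q)) mulr_sumr.
(* X j and X (j+1) differ only in one factor, 1 - c q^j against u - c q^j, and the difference of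
   these is 1 - u. *)
apply: eq_bigr => -[j /= ltjn] _; rewrite /X subSn// subSS qpochSl big_ord_recr /=.
have -> : \prod_(i < j) (u * q - c * q * q ^+ i)
    = q ^+ j * \prod_(i < j) (u - c * q ^+ i).
  by rewrite -prodrMl_ord; apply: eq_bigr => i _; ring.
by rewrite exprS -!mulrA [q * q ^+ j]mulrC; ring.
Qed.

(** The case c = 0 of q-Chu-Vandermonde: the two products become u^j and 1. *)
Lemma finite_qbinom n u :
  \sum_(j < n.+1) sbinom n j * u ^+ j = qpoch u q n.
Proof.
rewrite -(qChuVandermonde n u 0); apply: eq_bigr => j _.
have -> : \prod_(i < j) (u - 0 * q ^+ i) = u ^+ j.
  by under eq_bigr => i _ do rewrite mul0r subr0; rewrite prodr_const card_ord.
by rewrite mul0r /qpoch big1 ?mulr1// => i _; rewrite mul0r subr0.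
Qed.

(* The j-th coefficient of the 3phi2 in base 1/q, rewritten in base q. *)
Definition racah_coef a c y j :=
  qpoch (q ^- y) q j * qpoch (a * c ^+ 2 * q ^+ y) q j
  / (qpoch a q j * qpoch q q j) * c ^- (2 * j).

(** q-Chu-Vandermonde at u = t q^-y / c^2, with a t in the place of its c. Multiplied by E(t), this
    is G(t). *)
Lemma racah_coef_sum a c y t : c != 0 ->
  qpoch a q y != 0 -> qpoch (a * t) q y != 0 ->
  \sum_(j < y.+1) racah_coef a c y j * (t ^+ j * qpoch a q j / qpoch (a * t) q j)
  = qpoch (t * q ^- y / c ^+ 2) q y / qpoch (a * t) q y.
Proof.
move=> c0 ay0 aty0.
rewrite -(qChuVandermonde y _ (a * t)) mulr_suml.
apply: eq_bigr => -[j /= ltjy] _.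
have -> : \prod_(i < j) (t * q ^- y / c ^+ 2 - a * t * q ^+ i)
   = (t * q ^- y / c ^+ 2) ^+ j * qpoch (a * c ^+ 2 * q ^+ y) q j.
  rewrite -prodrMl_ord; apply: eq_bigr => i _.
  by field; rewrite expf_neq0// c0.
have aj0 := qpoch_neq0W (ltjy : (j <= y)%N) ay0.
move: aty0; rewrite (@qpoch_split (a * t) q j y)// mulf_eq0 negb_or => /andP[h1 h2].
rewrite /racah_coef /sbinom !exprMn !exprVn -!exprM.
have hq := qpoch_self_neq0 j; have hn := expf_neq0 (y * j) q_neq0.
have hc := expf_neq0 (2 * j) c0.
by field; rewrite hq hn hc h1 h2 aj0.
Qed.

(** * Terminating series and the two expansions of the 3phi2 in base 1/q *)

Lemma cvg_series_terminating (u : nat -> C) m :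
  (forall j, (m < j)%N -> u j = 0) ->
  series u n @[n --> \oo] --> \sum_(j < m.+1) u j.
Proof.
move=> u0; apply: cvg_near_cst; exists m.+1 => // n /= lt_mn.
rewrite /series /= (big_cat_nat (n := m.+1))//= big_mkord [X in _ + X]big_nat_cond.
by rewrite [X in _ + X]big1 ?addr0// => j /andP[/andP[lt_mj _] _]; exact: u0.
Qed.

Lemma qphi_sum us ls p z m :
  (forall j, (m < j)%N -> @qphi_term C us ls p z j = 0) ->
  qphi us ls p z = \sum_(j < m.+1) qphi_term us ls p z j.
Proof. by move=> term0; apply/cvg_lim => //; exact: cvg_series_terminating. Qed.

(** Cutting at y rather than at n makes the range independent of n, so that the sum over n can later
    be taken term by term. *)
Lemma qphi_racahV n a c y : a != 0 -> c != 0 ->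
  qphi [:: q ^+ n; q ^+ y; q ^- y / (a * c ^+ 2)] [:: a^-1; 0] q^-1 q^-1
  = \sum_(j < y.+1) racah_coef a c y j * qpoch (q ^+ n) q^-1 j.
Proof.
move=> a0 c0; rewrite (@qphi_sum _ _ _ _ y).
  apply: eq_bigr => -[j /= _] _.
  rewrite /qphi_term /racah_coef !big_cons !big_nil !mulr1.
  have -> : qpoch 0 q^-1 j = 1 by rewrite /qpoch big1// => i _; rewrite mul0r subr0.
  suff -> : qpoch (q ^- y) q j * qpoch (a * c ^+ 2 * q ^+ y) q j
      / (qpoch a q j * qpoch q q j) / c ^+ (2 * j)
    = qpoch (q ^+ y) q^-1 j * qpoch (q ^- y / (a * c ^+ 2)) q^-1 j
      / qpoch a^-1 q^-1 j * (q^-1 ^+ j / qpoch q^-1 q^-1 j) by rewrite mulr1; ring.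
  elim: j => [|j IHj]; first by rewrite !qpoch0 muln0 !expr0 !mulr1 !invr1 !mulr1.
  (* [ry] and [rx] are the ratios of consecutive terms in base q and in base 1/q; the induction only
     needs their equality. *)
  pose ry := (1 - q ^- y * q ^+ j) * (1 - a * c ^+ 2 * q ^+ y * q ^+ j)
     * (1 - a * q ^+ j)^-1 / (1 - q * q ^+ j) / c ^+ 2.
  pose rx := (1 - q ^+ y * q^-1 ^+ j) * (1 - q ^- y / (a * c ^+ 2) * q^-1 ^+ j)
     * (1 - a^-1 * q^-1 ^+ j)^-1 / (1 - q^-1 * q^-1 ^+ j) / q.
  have exy : ry = rx.
    rewrite /rx /ry.
    have -> : 1 - a^-1 * q^-1 ^+ j = (1 - a * q ^+ j) * - (a * q ^+ j)^-1.
      by rewrite exprVn; field; rewrite a0 expf_neq0.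
    (* Both sides carry the factor [w], so the equality also holds when 1 - a q^j = 0, where [w] is
       0 by convention. *)
    rewrite [((1 - a * q ^+ j) * _)^-1]invfM; set w := (1 - a * q ^+ j)^-1.
    have h1 : 1 - q * q ^+ j != 0 by rewrite subr_eq0 eq_sym -exprS.
    have h2 : q * q ^+ j - 1 != 0 by rewrite subr_eq0 -exprS.
    have hy := expf_neq0 y q_neq0; have hj := expf_neq0 j q_neq0.
    rewrite exprVn; field.
    by rewrite ?oppr_eq0 ?h1 ?h2 ?a0 ?c0 ?hy ?hj ?q_neq0 ?oppr_eq0 ?oner_eq0.
  rewrite !qpochS mulnS exprD (exprS q^-1) !invfM.
  transitivity (qpoch (q ^- y) q j * qpoch (a * c ^+ 2 * q ^+ y) q j /
        (qpoch a q j * qpoch q q j) / c ^+ (2 * j) * ry).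
    by rewrite /ry !invfM; ring.
  by rewrite IHj exy /rx !invfM; ring.
move=> j lt_yj; rewrite /qphi_term !big_cons.
have -> : qpoch (q ^+ y) q^-1 j = 0.
  by rewrite (@qpoch_eq0 _ _ y)// exprVn mulfV// expf_neq0.
by rewrite !(mul0r, mulr0).
Qed.

(** Read backwards, the factors are those of (z q^(1-j); q)_j, to which the finite q-binomial
    theorem applies. *)
Lemma qpochV_expand z j :
  qpoch z q^-1 j = \sum_(k < j.+1) sbinom j k * (z * q / q ^+ j) ^+ k.
Proof.
rewrite finite_qbinom// /qpoch [RHS](reindex_inj rev_ord_inj).
apply: eq_bigr => -[i /= ltij] _; congr (1 - _).
rewrite -{1}(subnK ltij) exprD exprS exprVn; field.
by rewrite ?expf_neq0 ?q_neq0.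
Qed.

(** In reverse order, 1 - q^-m / al = - (1 - al q^m) / (al q^m). The product of the - q^l stays
    unevaluated because it cancels between two uses with the same k. *)
Lemma qpoch_rev al k : al != 0 ->
  qpoch (q ^- k / al) q k
  = \prod_(l < k) - q ^+ l / (al * q ^+ k) ^+ k * qpoch (al * q) q k.
Proof.
move=> al0; rewrite /qpoch [X in _ = _ * X](reindex_inj rev_ord_inj) -(exprVn (al * _)).
rewrite [X in _ = X * _]mulrC -prodrMl_ord -big_split.
apply: eq_bigr => -[i /= ltik] _.
have -> : q ^+ k = q * q ^+ i * q ^+ (k - i.+1) by rewrite -exprS -exprD subnKC.
field.
by rewrite ?expf_neq0 ?q_neq0 ?al0.
Qed.

(** Expanding (z; 1/q)_j in powers of z and exchanging the sums turns the coefficient of z^k into a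
    q-Chu-Vandermonde sum of order x - k. *)
Lemma racah_coef_qpochV a b x z : b != 0 ->
  qpoch a q x != 0 -> qpoch (b ^+ 2 * q) q x != 0 ->
  \sum_(j < x.+1) racah_coef a b x j * qpoch z q^-1 j =
  \sum_(k < x.+1) qpoch (q ^- x / b ^+ 2) q x / qpoch a q x
    * (qpoch (q ^- x) q k * qpoch (a * b ^+ 2 * q ^+ x) q k
       / (qpoch (b ^+ 2 * q) q k * qpoch q q k) * q ^+ k) * z ^+ k.
Proof.
move=> b0 ax0 bx0.
transitivity (\sum_(j < x.+1) \sum_(k < x.+1)
   racah_coef a b x j * (sbinom j k * (z * q / q ^+ j) ^+ k)).
  apply: eq_bigr => -[j /= ltjx] _; rewrite qpochV_expand mulr_sumr.
  (* Since [sbinom j k] = 0 for k > j, the inner range extends to k <= x, independently of j. *)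
  rewrite (big_ord_widen x.+1 (fun k => 
     racah_coef a b x j * (sbinom j k * (z * q / q ^+ j) ^+ k)))//.
  rewrite big_mkcond; apply: eq_bigr => k _; case: ifPn => //.
  by rewrite -leqNgt => ltjk; rewrite sbinom_eq0// mul0r mulr0.
rewrite exchange_big; apply: eq_bigr => -[k /= lekx] _.
rewrite ltnS in lekx.
pose f j := racah_coef a b x j * (sbinom j k * (z * q / q ^+ j) ^+ k).
rewrite -(big_mkord xpredT f) (big_cat_nat (n := k))//=; last exact: leqW.
rewrite big_nat big1 ?add0r => [|j /andP[_ ltjk]]; last first.
  by rewrite /f sbinom_eq0// mul0r mulr0.
rewrite -{1}[k]add0n big_addn subSn// big_mkord.
(* The first x - k factors are the value of the coming q-Chu-Vandermonde sum; the last k, reversed,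
   cancel (b^2 q; q)_k. *)
have bx : qpoch (q ^- x / b ^+ 2) q x = qpoch (q ^- x / b ^+ 2) q (x - k)
    * (\prod_(l < k) - q ^+ l / (b ^+ 2 * q ^+ k) ^+ k * qpoch (b ^+ 2 * q) q k).
  rewrite -qpoch_rev ?expf_neq0// (qpoch_split _ _ (leq_subr k x)) subKn//.
  congr (_ * qpoch _ _ _).
  rewrite -{1}(subnK lekx) exprD; field.
  by rewrite ?expf_neq0 ?q_neq0 ?b0.
rewrite bx -(qChuVandermonde (x - k) (q ^- x / b ^+ 2) (a * q ^+ k)).
set w := \prod_(l < k) _; set s := \sum_(j < _) (_ * qpoch _ _ _).
have bk0 : qpoch (b ^+ 2 * q) q k != 0 by exact: qpoch_neq0W bx0.
have [qq0 bb0 qk0] : [/\ qpoch q q k != 0, b ^+ (2 * k) != 0 & q ^+ (k * k) != 0].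
  by rewrite qpoch_self_neq0// !expf_neq0.
transitivity (qpoch (q ^- x) q k * qpoch (a * b ^+ 2 * q ^+ x) q k
   / (qpoch a q x * qpoch q q k) * w * (z * q) ^+ k / (b ^+ (2 * k) * q ^+ (k * k)) * s);
  last by rewrite (exprMn k (b ^+ 2)) (exprMn k z) -!exprM; field; rewrite qk0 bb0 qq0 ax0 bk0.
rewrite /s mulr_sumr; apply: eq_bigr => -[i /= ltix] _.
have -> : \prod_(l < i) (q ^- x / b ^+ 2 - a * q ^+ k * q ^+ l)
   = (q ^- x / b ^+ 2) ^+ i * qpoch (a * b ^+ 2 * q ^+ x * q ^+ k) q i.
  by rewrite -prodrMl_ord; apply: eq_bigr => l _; field; rewrite expf_neq0// b0.
have leki : (k + i <= x)%N by rewrite -leq_subRL.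
have := ax0; rewrite (qpoch_split _ _ leki) mulf_eq0 negb_or -subnDA => /andP[h1 h2].
rewrite exprD mulrA in h2 *.
have h3 : qpoch (a * q ^+ k) q i != 0 by move: h1; rewrite qpochD mulf_eq0 negb_or => /andP[].
have h4 : qpoch a q k != 0 by exact: qpoch_neq0W ax0.
rewrite /f /racah_coef /sbinom addnC !(qpochD _ _ k).
have -> : qpoch (q ^- (k + i)) q k
   = w / (q ^+ i * q ^+ k) ^+ k * qpoch (q ^+ i * q) q k.
  rewrite -qpoch_rev ?expf_neq0//; congr qpoch.
  by rewrite exprD invfM.
(* Two ways of cutting (q; q)_(k+i). *)
have -> : qpoch (q * q ^+ k) q i
   = qpoch q q i * qpoch (q ^+ i * q) q k / qpoch q q k.
  apply: (mulfI qq0); rewrite -qpochD addnC qpochD [q ^+ i * q]mulrC; field.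
  by rewrite qq0.
have -> : q ^- x * q ^+ k = q ^- (x - k).
  by rewrite -{1}(subnK lekx) exprD; field; rewrite !expf_neq0.
have -> : (q ^- x / b ^+ 2) ^+ i = (q ^+ ((x - k) * i) * q ^+ (k * i) * b ^+ (2 * i))^-1.
  by rewrite -exprD -mulnDl subnK// -invfM exprVn exprMn -!exprM.
have -> : (z * q / q ^+ (k + i)) ^+ k = z ^+ k * q ^+ k / (q ^+ (k * k) * q ^+ (k * i)).
  by rewrite exprMn (exprMn k z) exprVn -!exprM -exprD -mulnDr mulnC.
have -> : (q ^+ i * q ^+ k) ^+ k = q ^+ (k * k) * q ^+ (k * i).
  by rewrite -!exprD -exprM -mulnDr mulnC addnC.
have -> : q ^+ ((k + i) * k) = q ^+ (k * k) * q ^+ (k * i).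
  by rewrite mulnDl exprD (mulnC i).
rewrite mulnDr (exprD b) (exprMn k z).
have h5 : qpoch q q i != 0 by exact: qpoch_self_neq0.
have h6 : qpoch (q ^+ i * q) q k != 0.
  have := qpoch_self_neq0 (i + k).
  by rewrite qpochD mulf_eq0 negb_or mulrC => /andP[].
have := expf_neq0 ((x - k) * i) q_neq0; have := expf_neq0 (k * i) q_neq0.
have := expf_neq0 (2 * i) b0 => h7 h8 h9.
field.
by rewrite h2 h3 h4 h5 h6 h7 h8 h9 qq0 bb0 qk0.
Qed.

End Base.
End Algebra.

(** * The q-binomial series and its functional equation *)

Section QBinomialSeries.
Set Implicit Arguments.
Unset Strict Implicit.
Variable C : numClosedFieldType.
Implicit Types (a b c d t z : C) (i j k m n x y : nat).

Lemma cvg_series_lincomb m (al l : 'I_m -> C) (f : 'I_m -> nat -> C) :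
  (forall k : 'I_m, series (f k) n @[n --> \oo] --> l k) ->
  series (fun n => \sum_(k < m) al k * f k n) n @[n --> \oo] --> \sum_(k < m) al k * l k.
Proof.
move=> fl.
have -> : (fun n => series (fun n => \sum_(k < m) al k * f k n) n)
   = (fun n => \sum_(k < m) al k * series (f k) n).
  apply/funext => n; rewrite /series /= exchange_big; apply: eq_bigr => k _.
  by rewrite mulr_sumr.
apply: cvg_big => [|k _]; last by apply: cvgMl_tmp; exact: fl.
exact: add_continuous.
Qed.

Lemma cvgn_unique (u : nat -> C) (l m : C) :
  u n @[n --> \oo] --> l -> u n @[n --> \oo] --> m -> l = m.
Proof. by move=> ul um; rewrite -(cvg_lim _ ul)//; exact/cvg_lim. Qed.

Section Base.
Variables (q a t : C) (E : nat -> C).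
Hypotheses (q_neq0 : q != 0) (q_expr : forall n, q ^+ n.+1 != 1).

Definition qbinom_term z n := z ^+ n * (qpoch a q n / qpoch q q n).

Lemma qbinom_termS z n :
  qbinom_term z n.+1 * (1 - q ^+ n.+1) = z * (1 - a * q ^+ n) * qbinom_term z n.
Proof.
rewrite /qbinom_term !qpochS (exprS z) -(exprS q) invfM.
have h : 1 - q ^+ n.+1 != 0 by rewrite subr_eq0 eq_sym.
by field; rewrite h qpoch_self_neq0.
Qed.

Lemma qbinom_term_shift z n : qbinom_term (z * q) n = q ^+ n * qbinom_term z n.
Proof. by rewrite /qbinom_term exprMn; ring. Qed.

(** Partial-sum form of (1 - z) E(z) = (1 - az) E(zq): the defect is a difference of two n-th
    terms. *)
Lemma series_qbinom_shift z n :
  (1 - z) * series (qbinom_term z) n - (1 - a * z) * series (qbinom_term (z * q)) n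
  = qbinom_term (z * q) n - qbinom_term z n.
Proof.
elim: n => [|n IHn].
  by rewrite /series /= !big_geq// !mulr0 subrr qbinom_term_shift mul1r subrr.
rewrite /series /= !big_nat_recr//= -/(series _ n) -/(series _ n).
have := qbinom_termS z n; rewrite !qbinom_term_shift exprS in IHn * => h.
set u := qbinom_term z n.+1 in h *; set v := qbinom_term z n in IHn h *.
rewrite !mulrDr opprD addrACA IHn.
apply/eqP; rewrite -subr_eq0; apply/eqP.
transitivity (u * (1 - q * q ^+ n) - z * (1 - a * q ^+ n) * v); first by ring.
by rewrite h subrr.
Qed.

(** Convergence is assumed here, so that |t| < 1 and the terminating case a = q^-N share what
    follows. *)
Hypothesis cvgE :
  forall i, series (qbinom_term (t * q ^+ i)) n @[n --> \oo] --> E i.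

(* Terms of a convergent series tend to 0, so no bound on q or t is needed. *)
Lemma qbinom_sum_shift i :
  (1 - a * (t * q ^+ i)) * E i.+1 = (1 - t * q ^+ i) * E i.
Proof.
apply/eqP; rewrite eq_sym -subr_eq0; apply/eqP.
have Ei := cvgE (i := i); have Ei1 := cvgE (i := i.+1).
rewrite exprSr mulrA in Ei1.
have h0 : (qbinom_term (t * q ^+ i * q) - qbinom_term (t * q ^+ i)) n @[n --> \oo] --> (0 : C).
  by rewrite -[0]subr0; apply: cvgB; apply: cvg_series_cvg_0; apply/cvg_ex; eexists; eassumption.
apply: (cvgn_unique _ h0).
have -> : qbinom_term (t * q ^+ i * q) - qbinom_term (t * q ^+ i)
    = (fun n => (1 - t * q ^+ i) * series (qbinom_term (t * q ^+ i)) n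
      - (1 - a * (t * q ^+ i)) * series (qbinom_term (t * q ^+ i * q)) n).
  by apply/funext => n; rewrite series_qbinom_shift.
by apply: cvgB; apply: cvgMl_tmp.
Qed.

(** Iterates the functional equation, without division because (at; q)_k may vanish. *)
Lemma qbinom_sum_iter k : qpoch (a * t) q k * E k = qpoch t q k * E 0.
Proof.
elim: k => [|k IHk]; first by rewrite !qpoch0.
by rewrite !qpochS -mulrA -[a * t * _]mulrA qbinom_sum_shift mulrCA IHk; ring.
Qed.

(** Induction on j for all i at once: the new factor of (q^n; 1/q)_(j+1) is 1 - q^n q^-j, and q^n
    shifts t q^i to t q^(i+1). *)
Lemma cvg_series_qbinom_qpochV j i : qpoch (a * (t * q ^+ i)) q j != 0 ->
  series (fun n => qbinom_term (t * q ^+ i) n * qpoch (q ^+ n) q^-1 j) n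
    @[n --> \oo]
  --> (t * q ^+ i) ^+ j * qpoch a q j / qpoch (a * (t * q ^+ i)) q j * E i.
Proof.
elim: j i => [|j IHj] i.
  move=> _; rewrite !qpoch0 !mulr1 divr1 mul1r; have := cvgE (i := i).
  rewrite (_ : (fun n => _ * _) = qbinom_term (t * q ^+ i))//.
  by apply/funext => n; rewrite qpoch0 mulr1.
set z := t * q ^+ i.
have ez : t * q ^+ i.+1 = z * q by rewrite exprSr mulrA.
move=> h; have h1 := qpoch_neq0W (leqnSn j) h.
have h2 : qpoch (a * (t * q ^+ i.+1)) q j != 0.
  by move: h; rewrite qpochSl mulf_eq0 negb_or exprSr !mulrA => /andP[].
have h3 : 1 - a * z != 0.
  by move: h; rewrite qpochSl mulf_eq0 negb_or => /andP[].
have h4 : 1 - a * z * q ^+ j != 0.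
  by move: h; rewrite qpochS mulf_eq0 negb_or => /andP[].
pose u0 n := qbinom_term z n * qpoch (q ^+ n) q^-1 j.
pose u1 n := qbinom_term (t * q ^+ i.+1) n * qpoch (q ^+ n) q^-1 j.
have -> : (fun n => qbinom_term z n * qpoch (q ^+ n) q^-1 j.+1)
   = u0 - (fun n => q ^- j * u1 n).
  apply/funext => n; rewrite /u0 /u1 qpochS ez.
  by rewrite !fctE qbinom_term_shift exprVn; ring.
rewrite (_ : series _ = series u0 - (fun n => q ^- j * series u1 n)); last first.
  apply/funext => n; rewrite !fctE /series /= sumrB; congr (_ - _).
  by rewrite mulr_sumr.
rewrite [X in _ --> X](_ : _ = (z ^+ j * qpoch a q j / qpoch (a * z) q j * E i)
   - q ^- j * ((t * q ^+ i.+1) ^+ j * qpoch a q j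
               / qpoch (a * (t * q ^+ i.+1)) q j * E i.+1)).
  by apply: cvgB; [exact: IHj | apply: cvgMl_tmp; exact: IHj].
have -> : qpoch (a * (t * q ^+ i.+1)) q j
    = qpoch (a * z) q j * (1 - a * z * q ^+ j) / (1 - a * z).
  by rewrite -qpochS qpochSl ez mulrA [X in _ = X / _]mulrC mulfK.
have -> : E i.+1 = (1 - z) * E i / (1 - a * z).
  by rewrite -qbinom_sum_shift mulrC mulKf.
have hq := expf_neq0 j q_neq0.
rewrite !qpochS ez (exprMn j z) (exprSr z); field.
by rewrite h1 h3 h4 hq.
Qed.

(** The powers q^(nk) from the first 3phi2 are absorbed by replacing t with t q^k. Nonvanishing of
    (at; q)_(y+x) covers the denominators at every such shift. *)
Lemma cvg_series_racah b c x y :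
  a != 0 -> b != 0 -> c != 0 ->
  qpoch a q x != 0 -> qpoch a q y != 0 -> qpoch (b ^+ 2 * q) q x != 0 ->
  qpoch (a * t) q (y + x) != 0 ->
  series (fun n => qbinom_term t n
      * qphi [:: q ^+ n; q ^+ x; q ^- x / (a * b ^+ 2)] [:: a^-1; 0] q^-1 q^-1
      * qphi [:: q ^+ n; q ^+ y; q ^- y / (a * c ^+ 2)] [:: a^-1; 0] q^-1 q^-1) n
    @[n --> \oo]
  --> \sum_(k < x.+1) qpoch (q ^- x / b ^+ 2) q x / qpoch a q x
      * (qpoch (q ^- x) q k * qpoch (a * b ^+ 2 * q ^+ x) q k
       / (qpoch (b ^+ 2 * q) q k * qpoch q q k) * q ^+ k)
      * (qpoch (t * q ^+ k * q ^- y / c ^+ 2) q y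
         / qpoch (a * (t * q ^+ k)) q y * E k).
Proof.
move=> a0 b0 c0 ax0 ay0 bx0 atxy0.
pose al k := qpoch (q ^- x / b ^+ 2) q x / qpoch a q x
  * (qpoch (q ^- x) q k * qpoch (a * b ^+ 2 * q ^+ x) q k
     / (qpoch (b ^+ 2 * q) q k * qpoch q q k) * q ^+ k).
have atq_neq0 k : (k < x.+1)%N -> qpoch (a * (t * q ^+ k)) q y != 0.
  move=> ltkx; have := @qpoch_neq0W _ (a * t) q (k + y) (y + x).
  rewrite addnC leq_add2l => /(_ ltkx atxy0).
  by rewrite addnC qpochD mulf_eq0 negb_or mulrA => /andP[].
rewrite (_ : (fun n => _ * _ * _) = fun n => \sum_(k < x.+1) al k *
  \sum_(j < y.+1) racah_coef q a c y j
    * (qbinom_term (t * q ^+ k) n * qpoch (q ^+ n) q^-1 j)); last first.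
  apply/funext => n; rewrite !qphi_racahV// racah_coef_qpochV// -mulrA mulrC.
  rewrite !mulr_suml; apply: eq_bigr => k _.
  rewrite -/(al k) -[al k * _ * _]mulrA -mulrA; congr (_ * _).
  rewrite mulr_sumr mulr_suml; apply: eq_bigr => j _.
  by rewrite /qbinom_term exprMn -!exprM [(n * k)%N]mulnC; ring.
rewrite [X in _ --> X](_ : _ = \sum_(k < x.+1) al k *
  \sum_(j < y.+1) racah_coef q a c y j
    * ((t * q ^+ k) ^+ j * qpoch a q j / qpoch (a * (t * q ^+ k)) q j * E k)).
  apply: cvg_series_lincomb => -[k /= ltkx].
  apply: cvg_series_lincomb => -[j /= ltjy].
  by apply: cvg_series_qbinom_qpochV; apply: qpoch_neq0W (atq_neq0 k ltkx).
apply: eq_bigr => -[k /= ltkx] _; congr (_ * _).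
rewrite -racah_coef_sum//; last exact: atq_neq0.
by rewrite mulr_suml; apply: eq_bigr => j _; rewrite -[LHS]mulrA.
Qed.

End Base.
End QBinomialSeries.

(** * Convergence over the complex numbers and the infinite q-binomial theorem *)

Section ComplexSeries.
Set Implicit Arguments.
Unset Strict Implicit.
Variable R : realType.
Import ComplexField.
Local Open Scope complex_scope.

Lemma normc_ge0 (z : R[i]) : 0 <= Normc.normc z.
Proof. by case: z => ? ?; exact: sqrtr_ge0. Qed.

Lemma Cplx_norm_real (r : R) : `|r%:C : Cplx R| = (`|r|)%:C.
Proof. by rewrite normc_def /= expr0n addr0 sqrtr_sqr. Qed.

Lemma cvg_real_complex (f : nat -> R) (l : R) :
  f n @[n --> \oo] --> l -> ((f n)%:C : Cplx R) @[n --> \oo] --> (l%:C : Cplx R).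
Proof.
move=> /cvgrPdist_lt fl; apply/cvgrPdist_lt => e e0.
(* In the partial order, 0 < e forces e to be real, so its real part serves as the real epsilon. *)
have e_real : (@complex.Re R e)%:C = e by rewrite RRe_real// gtr0_real.
have := fl (@complex.Re R e); rewrite -ltcR e_real => /(_ e0); apply: filterS => n.
by rewrite -e_real -rmorphB Cplx_norm_real ltcR.
Qed.

(** The real and imaginary parts are dominated by the modulus, hence converge by comparison in [R];
    the complex limit is reassembled from theirs. *)
Lemma cvg_series_normc (u : nat -> Cplx R) :
  cvgn (series (fun n => @Normc.normc R (u n))) -> cvgn (series u).
Proof.
move=> cu.
have cRe : cvgn (series (fun n => @complex.Re R (u n))).
  apply: normed_cvg; apply: (series_le_cvg _ (fun n => normc_ge0 _) _ cu) => n;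
    first exact: normr_ge0.
  by rewrite -lecR; exact: normc_ge_Re (u n : R[i]).
have le_Im (z : R[i]) : `|complex.Im z| <= Normc.normc z.
  by case: z => v w /=; rewrite -sqrtr_sqr ler_wsqrtr// lerDr sqr_ge0.
have cIm : cvgn (series (fun n => @complex.Im R (u n))).
  by apply: normed_cvg; apply: (series_le_cvg _ (fun n => normc_ge0 _) _ cu) => n;
    [exact: normr_ge0 | exact: le_Im].
apply/cvg_ex; exists ((limn (series (fun n => @complex.Re R (u n))))%:C
   + 'i * (limn (series (fun n => @complex.Im R (u n))))%:C : Cplx R).
rewrite (_ : series u = fun n => (series (fun n => @complex.Re R (u n)) n)%:C
   + 'i * (series (fun n => @complex.Im R (u n)) n)%:C); last first.
  apply/funext => n; rewrite /series /= !rmorph_sum mulr_sumr -big_split.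
  by apply: eq_bigr => i _; exact: complexE.
apply: (@cvgD _ (Cplx R)); first exact: cvg_real_complex.
by apply: (@cvgMl_tmp (Cplx R)); exact: cvg_real_complex.
Qed.

Lemma ratio_test (v : nat -> R) (r : R) : 0 < r < 1 -> (forall n, 0 <= v n) ->
  (\forall n \near \oo, v n.+1 <= r * v n) -> cvgn (series v).
Proof.
move=> /andP[r0 r1] v_ge0 [N _ vN].
(* [M] is chosen so that M r^k >= v k for all k <= N; beyond N the ratio bound takes over. *)
pose M := \sum_(k < N.+1) v k / r ^+ k.
have vM n : v n <= geometric M r n.
  rewrite /=; elim: n => [|n IHn].
    rewrite expr0 mulr1 /M big_ord_recl expr0 divr1 lerDl.
    by apply: sumr_ge0 => k _; rewrite divr_ge0// exprn_ge0// ltW.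
  have [ltnN|leNn] := ltnP n N.
    rewrite -ler_pdivrMr ?exprn_gt0// /M (bigD1 (Ordinal (ltnN : (n.+1 < N.+1)%N)))//= lerDl.
    by apply: sumr_ge0 => k _; rewrite divr_ge0// exprn_ge0// ltW.
  apply: (le_trans (vN n leNn)).
  by rewrite exprS mulrCA ler_pM2l.
apply: (series_le_cvg v_ge0 _ vM) => [n|]; first exact: le_trans (vM n).
by apply: is_cvg_geometric_series; rewrite gtr0_norm.
Qed.

Section QBinomial.
Variables (q : Cplx R).
Hypotheses (q_gt0 : 0 < q) (q_lt1 : q < 1).

Let q_neq0 : q != 0. Proof. by rewrite gt_eqF. Qed.

Let q_expr n : q ^+ n.+1 != 1.
Proof. by rewrite lt_eqF// exprn_ilt1// ltW. Qed.

Lemma cvg_series_qbinom_normc (a t : Cplx R) : `|t| < 1 ->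
  cvgn (series (fun n => @Normc.normc R (qbinom_term q a t n))).
Proof.
pose tau := @Normc.normc R t; pose al := @Normc.normc R a.
pose p := @complex.Re R q.
have qp : q = p%:C by rewrite RRe_real// gtr0_real.
have p0 : 0 < p by rewrite -ltcR -qp.
have p1 : p < 1 by rewrite -ltcR -qp.
move=> t1; have {}t1 : tau < 1 by rewrite -ltcR.
(* The term ratios tend to |t| in modulus; the midpoint of |t| and 1 eventually exceeds them. *)
pose r := (1 + tau) / 2.
have tau0 : 0 <= tau by exact: normc_ge0.
have r01 : 0 < r < 1 by apply/andP; split; rewrite /r; lra.
apply: (ratio_test r01) => [n|]; first exact: normc_ge0.
have pn0 : p ^+ n @[n --> \oo] --> (0 : R).
  have := @cvg_geometric R 1 p; rewrite gtr0_norm// => /(_ p1).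
  by apply: cvg_trans; apply: near_eq_cvg; apply: nearW => n /=; rewrite mul1r.
(* Nonpositivity of this expression is tau (1 + al p^n) <= r (1 - p^(n+1)), the ratio bound cleared
   of its denominator. *)
have g0 : (tau - r) + (al * tau + r * p) * p ^+ n @[n --> \oo] --> tau - r.
  rewrite -[X in _ --> X]addr0 -[X in _ --> _ + X](mulr0 (al * tau + r * p)).
  by apply: cvgD; [exact: cvg_cst | exact: cvgMl_tmp].
have g_lt0 : tau - r < 0 by rewrite /r; lra.
apply: filterS (cvgr_le _ g0 _ g_lt0) => n gn.
have pS : 0 < 1 - p ^+ n.+1 by rewrite subr_gt0 exprn_ilt1// ltW.
rewrite -(ler_pM2r pS).
have normc_real (x : R) : 0 <= x -> Normc.normc (x%:C) = x.
  by move=> x0; rewrite /= expr0n addr0 sqrtr_sqr ger0_norm.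
have := qbinom_termS a q_expr t n.
move: (qbinom_term q a t n.+1) (qbinom_term q a t n) => u v.
move=> /(congr1 (@Normc.normc R)); rewrite !Normc.normcM -/tau.
have -> : Normc.normc (1 - q ^+ n.+1 : R[i]) = 1 - p ^+ n.+1.
  by rewrite qp -rmorphXn -(rmorph1 (real_complex R)) -rmorphB normc_real// ltW.
move=> ->.
have le1 : Normc.normc (1 - a * q ^+ n : R[i]) <= 1 + al * p ^+ n.
  apply: le_trans (le_normcD _ _) _; rewrite normcN Normc.normcM Normc.normc1.
  by rewrite lerD2l ler_wpM2l ?normc_ge0// qp -rmorphXn normc_real// exprn_ge0// ltW.
rewrite [leRHS]mulrAC; apply: ler_wpM2r; first exact: normc_ge0.
apply: le_trans (ler_wpM2l tau0 le1) _.
by move: gn; rewrite exprS; lra.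
Qed.

Lemma is_cvg_series_qbinom (a t : Cplx R) : `|t| < 1 ->
  cvgn (series (qbinom_term q a t)).
Proof. by move=> /(cvg_series_qbinom_normc (a := a))/cvg_series_normc. Qed.

(** At a = t = q the q-binomial series is the geometric series, and its terms tend to 0. *)
Lemma cvg_qexp0 : q ^+ n @[n --> \oo] --> (0 : Cplx R).
Proof.
have : cvgn (series (qbinom_term q q q)).
  by apply: is_cvg_series_qbinom; rewrite gtr0_norm.
move=> /cvg_series_cvg_0; rewrite (_ : qbinom_term q q q = fun n => q ^+ n)//.
by apply/funext => n; rewrite /qbinom_term divff ?mulr1// qpoch_self_neq0.
Qed.

Lemma norm_mul_qexp_lt1 (t : Cplx R) k : `|t| < 1 -> `|t * q ^+ k| < 1.
Proof.
move=> t1; rewrite normrM; apply: le_lt_trans t1.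
by rewrite ler_piMr// normrX exprn_ile1// gtr0_norm// ltW.
Qed.

(** [K] is the sum of the moduli at t: each term of index i + 1 gains q^(k(i+1)) <= q^k. The length
    [n.+1] ensures that the leading term 1 is present. *)
Lemma series_qbinom_subr1_le (a t : Cplx R) : `|t| < 1 ->
  exists K : Cplx R, forall n k,
    `|series (qbinom_term q a (t * q ^+ k)) n.+1 - 1| <= K * q ^+ k.
Proof.
move=> /(cvg_series_qbinom_normc (a := a)) cu.
pose v n := @Normc.normc R (qbinom_term q a t n).
exists (limn (series v))%:C => n k.
have leK : (series v n.+1)%:C <= (limn (series v))%:C :> R[i].
  rewrite lecR; apply: nondecreasing_cvgn_le cu _.
  by apply: nondecreasing_series => i _ _; exact: normc_ge0.
have qk_ge0 : 0 <= q ^+ k by rewrite exprn_ge0// ltW.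
apply: le_trans (ler_wpM2r qk_ge0 leK).
rewrite /series /= !big_nat_recl//= {1}/qbinom_term expr0 !qpoch0 divr1 mulr1.
rewrite addrAC subrr add0r.
apply: le_trans (ler_norm_sum _ _ _) _.
rewrite rmorphD mulrDl; apply: ler_wpDl.
  by rewrite mulr_ge0// lecR; exact: normc_ge0.
rewrite rmorph_sum mulr_suml; apply: ler_sum => i _.
have -> : qbinom_term q a (t * q ^+ k) i.+1 = qbinom_term q a t i.+1 * q ^+ (k * i.+1).
  by rewrite /qbinom_term exprMn -exprM; ring.
rewrite normrM (ger0_norm (exprn_ge0 _ (ltW q_gt0))); apply: ler_wpM2l => //.
by rewrite mulnS exprD ler_piMr// exprn_ile1// ltW.
Qed.

(** The preceding bound is uniform in n, so it controls the limits as t q^k tends to 0. *)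
Lemma cvg_qbinom_sum1 (a t : Cplx R) : `|t| < 1 ->
  limn (series (qbinom_term q a (t * q ^+ k))) @[k --> \oo] --> (1 : Cplx R).
Proof.
move=> t1; have [K leK] := series_qbinom_subr1_le a t1.
apply/cvgrPdist_lt => e e0.
have Kq0 : K * q ^+ k @[k --> \oo] --> (0 : Cplx R).
  by rewrite -(mulr0 K); apply: cvgMl_tmp; exact: cvg_qexp0.
have e2 : 0 < e / 2 by rewrite divr_gt0.
move/cvgrPdist_lt : Kq0 => /(_ _ e2); apply: filterS => k.
rewrite sub0r normrN => Kk.
have := is_cvg_series_qbinom (a := a) (norm_mul_qexp_lt1 k t1).
move=> /cvgrPdist_lt /(_ _ e2)[N _ /(_ N.+1 (leqnSn _))].
set S := series _ _; set L := limn _ => /= LS.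
have -> : 1 - L = (S - L) - (S - 1) by ring.
rewrite [ltRHS]splitr; apply: le_lt_trans (ler_normB _ _) _.
apply: ltrD; first by rewrite distrC.
apply: le_lt_trans Kk; apply: le_trans (leK N k) _.
(* [K] is an arbitrary complex number here; K q^k is real because it bounds a modulus. *)
apply: real_ler_norm; apply: ger0_real.
by apply: le_trans (leK N k); exact: normr_ge0.
Qed.

(* With a = 0 the sums E k at t q^k satisfy E k = (t;q)_k E 0 and tend to 1,
   which gives the convergence of the product and its nonzero limit at once. *)
Lemma cvg_qpoch_neq0 (t : Cplx R) : `|t| < 1 ->
  exists2 l : Cplx R, l != 0 & qpoch t q n @[n --> \oo] --> l.
Proof.
move=> t1; have E1 := cvg_qbinom_sum1 0 t1.
set E := fun k => limn (series (qbinom_term q 0 (t * q ^+ k))) in E1.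
have EE k : E k = qpoch t q k * E 0.
  rewrite -(@qbinom_sum_iter _ q 0 t E q_expr).
    by rewrite /qpoch big1 ?mul1r// => i _; rewrite !mul0r subr0.
  by move=> i; apply: is_cvg_series_qbinom; exact: norm_mul_qexp_lt1.
have E0 : E 0 != 0.
  apply/eqP => E0; have E00 : E = fun=> 0 by apply/funext => k; rewrite EE E0 mulr0.
  rewrite E00 in E1; have /eqP := oner_neq0 (Cplx R); apply.
  by apply: (cvgn_unique E1); exact: cvg_cst.
exists (1 / E 0); first by rewrite div1r invr_eq0.
rewrite (_ : (fun n => qpoch t q n) = fun n => E n / E 0).
  exact: cvgMr_tmp.
by apply/funext => n; rewrite [E n]EE mulfK.
Qed.

(** Once |al q^N| < 1 the tail converges; the first N factors are split off. *)
Lemma cvg_qpoch_inf (al : Cplx R) :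
  qpoch al q n @[n --> \oo] --> (qpoch_inf al q : Cplx R).
Proof.
have al0 : al * q ^+ n @[n --> \oo] --> (0 : Cplx R).
  by rewrite -(mulr0 al); apply: cvgMl_tmp; exact: cvg_qexp0.
move/cvgrPdist_lt : al0 => /(_ 1 ltr01)[N _ /(_ N (leqnn N))].
rewrite /= sub0r normrN => /cvg_qpoch_neq0[l _ ql].
have qNl : qpoch al q n @[n --> \oo] --> qpoch al q N * l.
  rewrite -(cvg_shiftn N).
  rewrite (_ : [sequence _]_n = fun n => qpoch al q N * qpoch (al * q ^+ N) q n).
    exact: cvgMl_tmp.
  by apply/funext => n; rewrite /= addnC qpochD.
by have -> : qpoch_inf al q = qpoch al q N * l by exact/cvg_lim.
Qed.

(** The sequence (at; q)_k E(t q^k) = (t; q)_k E(t) has two expressions for its limit: (at; q)_oo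
    and (t; q)_oo E(t). *)
Lemma qbinomial_theorem (a t : Cplx R) : `|t| < 1 ->
  series (qbinom_term q a t) n @[n --> \oo]
  --> (qpoch_inf (a * t) q / qpoch_inf t q : Cplx R).
Proof.
move=> t1; pose E k := limn (series (qbinom_term q a (t * q ^+ k))).
have cE i : series (qbinom_term q a (t * q ^+ i)) n @[n --> \oo] --> E i.
  by apply: is_cvg_series_qbinom; exact: norm_mul_qexp_lt1.
have [l l0 tl] := cvg_qpoch_neq0 t1.
have -> : qpoch_inf t q = l by apply/cvg_lim.
suff -> : qpoch_inf (a * t) q / l = E 0.
  by have := cE 0; rewrite expr0 mulr1.
apply: (mulIf l0); rewrite divfK//.
have c1 : qpoch (a * t) q k * E k @[k --> \oo] --> qpoch_inf (a * t) q * 1.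
  by apply: cvgM; [exact: cvg_qpoch_inf | exact: cvg_qbinom_sum1].
have c2 : qpoch (a * t) q k * E k @[k --> \oo] --> l * E 0.
  rewrite (_ : (fun k => _ * _) = fun k => qpoch t q k * E 0).
    exact: (cvgMr_tmp (b := E 0) tl).
  by apply/funext => k; exact: (qbinom_sum_iter q_expr cE k).
by rewrite -[LHS]mulr1 [RHS]mulrC; apply: (cvgn_unique c1 c2).
Qed.

End QBinomial.
End ComplexSeries.

(** * The terminating q-binomial sum and the 4phi3 form of the limit *)

Section RacahSum.
Set Implicit Arguments.
Unset Strict Implicit.
Variables (C : numClosedFieldType) (q : C).
Hypotheses (q_neq0 : q != 0) (q_expr : forall n : nat, q ^+ n.+1 != 1).

(** The factors 1 - a q^i and 1 - a^-1 q^-i vanish together. *)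
Lemma qpoch_neq0_inv (a : C) n : a != 0 -> qpoch a^-1 q^-1 n != 0 -> qpoch a q n != 0.
Proof.
move=> a0 /prodf_neq0 an0; apply/prodf_neq0 => i _; move: (an0 i isT).
rewrite !subr_eq0; apply: contra => /eqP ai; apply/eqP.
by rewrite exprVn -invfM -ai invr1.
Qed.

(** The finite q-binomial theorem at u = q^-N z, where q^(-Nj) cancels the power of q in
    [sbinom]. *)
Lemma cvg_series_qbinom_finite N z :
  series (qbinom_term q (q ^- N) z) n @[n --> \oo] --> qpoch (q ^- N * z) q N.
Proof.
rewrite -finite_qbinom//.
rewrite (eq_bigr (fun j : 'I_N.+1 => qbinom_term q (q ^- N) z j)).
  apply: cvg_series_terminating => j ltNj.
  by rewrite /qbinom_term qpochVexp_eq0// mul0r mulr0.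
move=> -[j /= _] _; rewrite /sbinom /qbinom_term exprMn exprVn -exprM.
have hq := expf_neq0 (N * j) q_neq0.
by field; rewrite hq qpoch_self_neq0.
Qed.

Lemma cvg_series_racah_qphi (a b c d : C) (x y : nat) (E : nat -> C) :
  a != 0 -> b != 0 -> c != 0 ->
  qpoch a q x != 0 -> qpoch a q y != 0 ->
  qpoch (a * b * c * d) q y != 0 ->
  qpoch (b ^+ 2 * q) q x != 0 ->
  qpoch (b * d * q ^- y / c) q x != 0 ->
  qpoch (a * b * c * d * q ^+ y) q x != 0 ->
  (forall i, series (qbinom_term q a (b * c * d * q ^+ i)) n @[n --> \oo] --> E i) ->
  series (fun n =>
    (b * c * d) ^+ n * (qpoch a q n / qpoch q q n)
    * qphi [:: q ^+ n; q ^+ x; q ^- x / (a * b ^+ 2)] [:: a^-1; 0] q^-1 q^-1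
    * qphi [:: q ^+ n; q ^+ y; q ^- y / (a * c ^+ 2)] [:: a^-1; 0] q^-1 q^-1) n
    @[n --> \oo] -->
    E 0 * (qpoch (b * d * q ^- y / c) q y / qpoch (a * b * c * d) q y
    * (qpoch (q ^- x / b ^+ 2) q x / qpoch a q x)
    * qphi [:: q ^- x; a * b ^+ 2 * q ^+ x; b * c * d; b * d / c]
           [:: b ^+ 2 * q; b * d * q ^- y / c; a * b * c * d * q ^+ y] q q).
Proof.
move=> a0 b0 c0 ax0 ay0 aty0 bx0 vx0 atyx0 cE.
set t := b * c * d in cE *; set v := b * d * q ^- y / c in vx0 *.
have et : a * b * c * d = a * t by rewrite /t !mulrA.
rewrite et in aty0 atyx0 *.
have at0 : qpoch (a * t) q (y + x) != 0 by rewrite qpochD mulf_neq0.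
(* The upper parameter bd/c is the lower parameter [v] shifted by y, which lets the shifted
   factorials be recut below. *)
have -> : b * d / c = v * q ^+ y by rewrite /v; field; rewrite c0 expf_neq0.
rewrite (@qphi_sum _ _ _ _ _ x); last first.
  by move=> j ltxj; rewrite /qphi_term big_cons qpochVexp_eq0// !mul0r.
have := cvg_series_racah q_neq0 q_expr cE a0 b0 c0 ax0 ay0 bx0 at0.
rewrite [X in _ --> X -> _](_ : _ = E 0 * (qpoch v q y / qpoch (a * t) q y
    * (qpoch (q ^- x / b ^+ 2) q x / qpoch a q x)
    * \sum_(j < x.+1) qphi_term [:: q ^- x; a * b ^+ 2 * q ^+ x; t; v * q ^+ y]
       [:: b ^+ 2 * q; v; a * t * q ^+ y] q q j))//.
rewrite !mulr_sumr; apply: eq_bigr => -[k /= ltkx] _.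
rewrite /qphi_term !big_cons !big_nil !mulr1.
have vk0 := qpoch_neq0W (ltkx : (k <= x)%N) vx0.
have bk0 := qpoch_neq0W (ltkx : (k <= x)%N) bx0.
have atky0 : qpoch (a * t) q (k + y) != 0.
  by apply: qpoch_neq0W at0; rewrite addnC leq_add2l.
have [atk0 atqk0] : qpoch (a * t) q k != 0 /\ qpoch (a * t * q ^+ k) q y != 0.
  by move: atky0; rewrite qpochD mulf_eq0 negb_or => /andP.
have -> : t * q ^+ k * q ^- y / c ^+ 2 = v * q ^+ k.
  by rewrite /t /v; field; rewrite c0 expf_neq0.
rewrite (mulrA a t).
have -> : E k = qpoch t q k * E 0 / qpoch (a * t) q k.
  by rewrite -(qbinom_sum_iter q_expr cE) mulrC mulKf.
(* Two cuts of (v; q)_(k+y); the next rewriting does the same for a t. *)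
have -> : qpoch (v * q ^+ k) q y = qpoch v q y * qpoch (v * q ^+ y) q k / qpoch v q k.
  by apply: (mulfI vk0); rewrite -!qpochD addnC; field.
have -> : qpoch (a * t * q ^+ y) q k
   = qpoch (a * t) q k * qpoch (a * t * q ^+ k) q y / qpoch (a * t) q y.
  by apply: (mulfI aty0); rewrite -!qpochD addnC; field.
have qk0 := qpoch_self_neq0 q_expr k.
field.
by rewrite vk0 atk0 atqk0 aty0 bk0 qk0 ax0.
Qed.

End RacahSum.

(* The hypotheses after hq1 say that every denominator displayed in the
   identity is nonzero, up to the index where the series terminates. *)
Theorem lemma2p1 (R : realType) (q a b c d : Cplx R) (x y : nat)
    (hq0 : 0 < q) (hq1 : q != 1)
    (ha : a != 0) (hb : b != 0) (hc : c != 0)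
    (hax : qpoch a q x != 0)
    (habcd : qpoch (a * b * c * d) q y != 0)
    (hphi1 : qpoch (b ^+ 2 * q) q x != 0)
    (hphi2 : qpoch (b * d * q ^- y / c) q x != 0)
    (hphi3 : qpoch (a * b * c * d * q ^+ y) q x != 0)
    (hphix : qpoch a^-1 q^-1 x != 0)
    (hphiy : qpoch a^-1 q^-1 y != 0) :
  let F : Cplx R :=
    qpoch (b * d * q ^- y / c) q y / qpoch (a * b * c * d) q y
    * (qpoch (q ^- x / b ^+ 2) q x / qpoch a q x)
    * qphi [:: q ^- x; a * b ^+ 2 * q ^+ x; b * c * d; b * d / c]
           [:: b ^+ 2 * q; b * d * q ^- y / c; a * b * c * d * q ^+ y] q q in
  let S : nat -> Cplx R := fun n =>
    (b * c * d) ^+ n * (qpoch a q n / qpoch q q n)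
    * qphi [:: q ^+ n; q ^+ x; q ^- x / (a * b ^+ 2)] [:: a^-1; 0] q^-1 q^-1
    * qphi [:: q ^+ n; q ^+ y; q ^- y / (a * c ^+ 2)] [:: a^-1; 0] q^-1 q^-1 in
  (`|b * c * d| < 1 -> q < 1 ->
     series S n @[n --> \oo] -->
       qpoch_inf (a * b * c * d) q / qpoch_inf (b * c * d) q * F)
  /\
  (forall N : nat, a = q ^- N ->
     series S n @[n --> \oo] --> qpoch (q ^- N * b * c * d) q N * F).
Proof.
move=> F S.
have q_neq0 : q != 0 by rewrite gt_eqF.
have q_expr n : q ^+ n.+1 != 1 by rewrite pexpr_eq1// ltW.
have ay : qpoch a q y != 0 by exact: qpoch_neq0_inv hphiy.
(* Each case now only has to supply the sums of the q-binomial series at bcd q^i; the one at i = 0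
   is the prefactor. *)
have cS (E : nat -> Cplx R) l : E 0 = l ->
    (forall i, series (qbinom_term q a (b * c * d * q ^+ i)) n @[n --> \oo] --> E i) ->
    series S n @[n --> \oo] --> l * F.
  by move=> <-; exact: cvg_series_racah_qphi.
split=> [t1 q1 | N aN].
  pose E i : Cplx R := qpoch_inf (a * (b * c * d * q ^+ i)) q / qpoch_inf (b * c * d * q ^+ i) q.
  apply: (cS E) => [|i]; first by rewrite /E expr0 mulr1 !mulrA.
  by apply: qbinomial_theorem => //; exact: norm_mul_qexp_lt1.
apply: (cS (fun i => qpoch (q ^- N * (b * c * d * q ^+ i)) q N)) => [|i].
  by rewrite expr0 mulr1 !mulrA.
by rewrite aN; exact: cvg_series_qbinom_finite.
Qed.
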